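(* No randomized online algorithm for the dicut model has a competitive ratio better than $4/5$, and no deterministic online algorithm for the dicut model has a competitive ratio better than $\frac{5-\sqrt{17}}{2}\approx 0.438$. Both statements hold even if the algorithm is given access to all arcs of $G$ (and their weights), including arcs leaving unrevealed elements.
   Context: The dicut model: there is a directed graph $G=(V,A)$ with non-negative arc weights, and an unknown ground set $\mathcal N=\{u_1,\dots,u_n\}\subseteq V$. The objective $f:2^{\mathcal N}\to\mathbb R_{\ge0}$ is the cut function: $f(S)$ is the total weight of arcs of $G$ going from a node of $S$ to a node of $V\setminus S$. The elements of $\mathcal N$ are revealed one by one in the order $u_1,\dots,u_n$, chosen by an adversary. The algorithm knows $V$, but does not know $\mathcal N$, $n$ or the revelation order in advance (so from its point of view the input might end after every element). At any time it can query the existence and weight of every arc leaving a node that has already been revealed. It maintains solutions $S_0=\varnothing,S_1,\dots,S_n$, where immediately after $u_i$ is revealed it chooses $S_i$ to be any subset of $S_{i-1}\cup\{u_i\}$, based only on the information available so far (and, for randomized algorithms, internal randomness). Every subset of $\mathcal N$ is feasible. The computational power of the algorithm is not restricted. The algorithm is $\alpha$-competitive (has competitive ratio at least $\alpha$) if $\mathbb E[f(S_n)]\ge\alpha\cdot\max_{S\subseteq\mathcal N}f(S)$ for every instance. The instance is fixed independently of the outcome of the algorithm's random choices, but may depend on the algorithm. *)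

(* Defs.v *)
From HB Require Import structures.
From mathcomp Require Import all_boot all_order all_algebra.
From mathcomp Require Import all_classical all_reals all_analysis.
Set Implicit Arguments.
Unset Strict Implicit.
Unset Printing Implicit Defensive.
Import Order.TTheory GRing.Theory Num.Theory.
Local Open Scope classical_set_scope.
Local Open Scope ring_scope.

(* An arc may be present with weight 0; the value of [weight] on pairs that are
   not arcs carries no meaning. *)
Record digraph (R : realType) (V : finType) := Digraph {
  arc : rel V;
  weight : V -> V -> R;
  weight_ge0 : forall u v, arc u v -> 0 <= weight u v
}.

Definition dicut (R : realType) (V : finType) (G : digraph R V) (T : {set V}) : R :=
  \sum_(u in T) \sum_(v | (v \notin T) && arc G u v) weight G u v.

(* The list [s] holds the elements u_1, ..., u_n of the ground set in their
   revelation order. The default 0 of the maximum is dicut G set0. *)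
Definition opt (R : realType) (V : finType) (G : digraph R V) (s : seq V) : R :=
  \big[Num.max/0]_(T : {set V} | T \subset s) dicut G T.

(* Which arcs an algorithm may query: those leaving a revealed node, or all. *)
Inductive access := RevealedArcs | AllArcs.

Definition queryable (acc : access) (V : finType) (s : seq V) (u : V) : bool :=
  if acc is RevealedArcs then u \in s else true.

(* No query allowed after the elements of [s] have been revealed separates
   [G] from [G']. *)
Definition same_info (acc : access) (R : realType) (V : finType) (s : seq V)
    (G G' : digraph R V) : Prop :=
  forall u v, queryable acc s u ->
    arc G u v = arc G' u v /\ (arc G u v -> weight G u v = weight G' u v).

(* [sol alg G s] is the solution S_i held immediately after the elements of
   [s] = [:: u_1; ...; u_i] have been revealed. It is a function of the prefix
   [s] only, and, through [sol_info], of the arcs queryable by then; earlier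
   solutions are determined by the same data. Lists with repetitions are never
   instances, see [det_competitive] and [rand_competitive]. *)
Record det_alg (R : realType) (acc : access) := DetAlg {
  sol : forall V : finType, digraph R V -> seq V -> {set V};
  sol_nil : forall (V : finType) (G : digraph R V), sol G [::] = finset.set0;
  sol_rcons : forall (V : finType) (G : digraph R V) (s : seq V) (u : V),
    sol G (rcons s u) \subset (u |: sol G s)%SET;
  sol_info : forall (V : finType) (s : seq V) (G G' : digraph R V),
    same_info acc s G G' -> sol G s = sol G' s
}.

Definition det_competitive (R : realType) (acc : access) (alg : det_alg R acc)
    (a : R) : Prop :=
  forall (V : finType) (G : digraph R V) (s : seq V), uniq s ->
    a * opt G s <= dicut G (sol alg G s).

(* The internal randomness is a point of an arbitrary probability space; each of
   its outcomes fixes a deterministic algorithm. *)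
Record rand_alg (R : realType) (acc : access) := RandAlg {
  rdisp : measure_display;
  rspace : measurableType rdisp;
  rprob : probability rspace R;
  rrun : rspace -> det_alg R acc;
  rrun_measurable : forall (V : finType) (G : digraph R V) (s : seq V)
    (T : {set V}), measurable [set w | sol (rrun w) G s = T]
}.

Arguments rrun {R acc} alg w : rename.

Definition rand_competitive (R : realType) (acc : access) (alg : rand_alg R acc)
    (a : R) : Prop :=
  forall (V : finType) (G : digraph R V) (s : seq V), uniq s ->
    ((a * opt G s)%:E <= 'E_(rprob alg)[fun w => dicut G (sol (rrun alg w) G s)])%E.

(* Main.v *)
(** Both bounds come from one gadget, on which the algorithm learns nothing from
    its queries. Two hubs [h] and [h'] are joined by arcs of weight [x] in both
    directions, and each hub has two satellites, with arcs of weight [x] towards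
    it; there is also an arc of weight [y] from the hub to its first satellite.

    Randomized bound, with [x = 1] and [y = 0]. The hubs are revealed, then
    possibly the first satellite of one of them. After the hubs the optimum is 1,
    and keeping both of them yields 0. If the satellite of [h] comes next, the
    optimum is 2, but it can be reached only if [h'] was kept, and otherwise at
    most 1 can be reached. So the values obtained in the three scenarios always
    add up to at most 4, whereas the optima add up to 5.

    Deterministic bound. Let [r = (5 - sqrt 17) / 2], so that
    [r ^ 2 - 5 r + 2 = 0], let [y = r / 2] and [x = 1 - y], so that
    [x = r (1 + x)]. After the hubs the optimum is [x + y = 1] and keeping both
    yields [2 y = r], hence exactly one hub [h] is kept. Next comes the first
    satellite of [h]: the optimum becomes [1 + x], and every choice but [h] alone
    yields at most [x = r (1 + x)]. Then comes the second satellite of [h]: the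
    optimum is [1 + 2 x] and at most [1 < r (1 + 2 x)] can be reached. *)
Require Import Defs.
From mathcomp Require Import all_boot all_order all_algebra.
From mathcomp Require Import all_classical all_reals all_analysis.
From mathcomp Require Import measurable_realfun ring lra.
Import Order.TTheory GRing.Theory Num.Theory.
Local Open Scope ring_scope.

(** * Online solutions and cuts in general *)

Lemma sol_subset (R : realType) (acc : access) (alg : det_alg R acc)
    (V : finType) (G : digraph R V) (s : seq V) :
  {subset sol alg G s <= s}.
Proof.
elim/last_ind: s => [|s u IHs] v; first by rewrite sol_nil inE.
move=> /(fintype.subsetP (sol_rcons alg G s u)).
by rewrite !inE mem_rcons inE => /orP[->//|/IHs ->]; rewrite orbT.
Qed.

Lemma sol_notin (R : realType) (acc : access) (alg : det_alg R acc)
    (V : finType) (G : digraph R V) (s : seq V) (v : V) :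
  v \notin s -> (v \in sol alg G s) = false.
Proof. by move=> vs; apply/negP => /sol_subset; apply/negP. Qed.

Lemma sol_rcons_old (R : realType) (acc : access) (alg : det_alg R acc)
    (V : finType) (G : digraph R V) (s : seq V) (u v : V) : v != u ->
  v \in sol alg G (rcons s u) -> v \in sol alg G s.
Proof.
move=> /negPf vu /(fintype.subsetP (sol_rcons alg G s u)).
by rewrite !inE vu.
Qed.

Lemma dicut_le_opt (R : realType) (V : finType) (G : digraph R V) (s : seq V)
    (T : {set V}) : T \subset s -> dicut G T <= opt G s.
Proof. by move=> Ts; rewrite /opt; exact: (le_bigmax_cond _ (dicut G)). Qed.

Lemma dicut_ge0 (R : realType) (V : finType) (G : digraph R V) (T : {set V}) :
  0 <= dicut G T.
Proof.
by apply: sumr_ge0 => u _; apply: sumr_ge0 => v /andP[_]; exact: weight_ge0.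
Qed.

Lemma dicutE (R : realType) (V : finType) (G : digraph R V) (T : {set V}) :
  (forall u v, Defs.arc G u v) ->
  dicut G T =
  \sum_u \sum_v (if (u \in T) && (v \notin T) then weight G u v else 0).
Proof.
move=> arcG; rewrite /dicut big_mkcond; apply: eq_bigr => u _.
case: (u \in T) => /=; last by rewrite big1.
by rewrite big_mkcond; apply: eq_bigr => v _; rewrite arcG andbT.
Qed.

(** * The gadget and its cuts *)

Definition node : finType := (bool * 'I_3)%type.
Definition hub (b : bool) : node := (b, ord0).
Definition sat1 (b : bool) : node := (b, lift ord0 ord0).
Definition sat2 (b : bool) : node := (b, lift ord0 (lift ord0 ord0)).

Lemma sum_node (R : realType) (F : node -> R) (b : bool) :
  \sum_u F u = (F (hub b) + F (sat1 b) + F (sat2 b)) +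
    (F (hub (~~ b)) + F (sat1 (~~ b)) + F (sat2 (~~ b))).
Proof.
rewrite (eq_bigr (fun u => F (u.1, u.2))); last by case.
rewrite -(pair_bigA _ (fun b i => F (b, i))) big_bool /= !big_ord_recl !big_ord0.
by case: b; ring.
Qed.

Section Gadget.
Variables (R : realType) (x y : R).
Hypotheses (x_ge0 : 0 <= x) (y_ge0 : 0 <= y).

(** The first case also puts weight [x] on a loop at each hub; this is harmless, as a loop crosses
    no cut. *)
Definition gadget_weight (u v : node) : R :=
  match nat_of_ord u.2, nat_of_ord v.2 with
  | 0%N, 0%N => x
  | 0%N, 1%N => if u.1 == v.1 then y else 0
  | _.+1, 0%N => if u.1 == v.1 then x else 0
  | _, _ => 0
  end.

Lemma gadget_weight_ge0 (u v : node) : true -> 0 <= gadget_weight u v.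
Proof.
rewrite /gadget_weight; case: u v => [b i] [c j] _ /=.
by case: (nat_of_ord i) (nat_of_ord j) (b == c) => [|?] [|[|?]] [].
Qed.

Definition gadget : digraph R node :=
  @Digraph R node (fun _ _ => true) gadget_weight gadget_weight_ge0.

(** The share of side [b] in the cut, an arc between the hubs being counted at its tail. *)
Definition part (T : {set node}) (b : bool) : R :=
  if hub b \in T
  then x *+ (hub (~~ b) \notin T) + y *+ (sat1 b \notin T)
  else x *+ (sat1 b \in T) + x *+ (sat2 b \in T).

Lemma dicut_gadget (T : {set node}) (b : bool) :
  dicut gadget T = part T b + part T (~~ b).
Proof.
rewrite dicutE // (sum_node _ _ b) !(sum_node _ _ b) /part.
have eq1 : (b == ~~ b) = false by case: b.
have eq2 : (~~ b == b) = false by rewrite eq_sym.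
rewrite /= /gadget_weight /= !eqxx eq1 eq2 negbK.
case: (hub b \in T) (hub (~~ b) \in T) (sat1 b \in T) (sat1 (~~ b) \in T)
  (sat2 b \in T) (sat2 (~~ b) \in T) => [] [] [] [] [] [] /=; ring.
Qed.

Lemma dicut_one_hub (b : bool) : dicut gadget [set hub b] = x + y.
Proof.
rewrite (dicut_gadget _ b) /part !inE eqxx.
have [-> -> -> ->] : [/\ (hub (~~ b) == hub b) = false,
  (sat1 b == hub b) = false, (sat1 (~~ b) == hub b) = false &
  (sat2 (~~ b) == hub b) = false] by case: b.
by rewrite !addr0.
Qed.

Lemma dicut_hub_sat1 (b : bool) :
  dicut gadget [set hub (~~ b); sat1 b] = x + y + x.
Proof.
rewrite (dicut_gadget _ b) /part negbK !inE.
by case: b => /=; ring.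
Qed.

Lemma dicut_hub_sats (b : bool) :
  dicut gadget [set hub (~~ b); sat1 b; sat2 b] = x + y + (x + x).
Proof.
rewrite (dicut_gadget _ b) /part negbK !inE.
by case: b => /=; ring.
Qed.

End Gadget.

(** * Values of online solutions on the gadget *)

Definition hubs : seq node := [:: hub true; hub false].

Lemma dicut_sol_hubs (R : realType) (acc : access) (alg : det_alg R acc)
    (x y : R) (x_ge0 : 0 <= x) (y_ge0 : 0 <= y) (G := gadget R x y x_ge0 y_ge0)
    (T := sol alg G hubs) :
  dicut G T = if hub true \in T
    then if hub false \in T then y + y else x + y
    else if hub false \in T then x + y else 0.
Proof.
have sat b : ((sat1 b \in T) = false) * ((sat2 b \in T) = false).
  by split; apply: sol_notin; case: b.
rewrite (dicut_gadget _ _ _ _ _ _ true) /part /= !sat.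
by case: (hub true \in T) (hub false \in T) => [] [] /=; ring.
Qed.

Lemma dicut_sol_hubs_sat1 (R : realType) (acc : access) (alg : det_alg R acc)
    (x y : R) (x_ge0 : 0 <= x) (y_ge0 : 0 <= y) (b : bool)
    (G := gadget R x y x_ge0 y_ge0) (T := sol alg G (rcons hubs (sat1 b))) :
  dicut G T =
    (if hub b \in T
     then x *+ (hub (~~ b) \notin T) + y *+ (sat1 b \notin T)
     else x *+ (sat1 b \in T)) +
    (if hub (~~ b) \in T then x *+ (hub b \notin T) + y else 0).
Proof.
have sat1N : (sat1 (~~ b) \in T) = false.
  by apply: sol_notin; case: (b).
have sat2N c : (sat2 c \in T) = false.
  by apply: sol_notin; case: (b) c => [] [].
rewrite (dicut_gadget _ _ _ _ _ _ b) /part sat1N !sat2N negbK !addr0.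
by [].
Qed.

Lemma dicut_sol_hubs_sats (R : realType) (acc : access) (alg : det_alg R acc)
    (x y : R) (x_ge0 : 0 <= x) (y_ge0 : 0 <= y) (b : bool)
    (G := gadget R x y x_ge0 y_ge0)
    (T := sol alg G (rcons (rcons hubs (sat1 b)) (sat2 b))) :
  hub (~~ b) \notin T -> sat1 b \notin T ->
  dicut G T = if hub b \in T then x + y else x *+ (sat2 b \in T).
Proof.
move=> hubN sat1N.
have satN : ((sat1 (~~ b) \in T) = false) * ((sat2 (~~ b) \in T) = false).
  by split; apply: sol_notin; case: (b).
rewrite (dicut_gadget _ _ _ _ _ _ b) /part !satN hubN (negPf hubN).
by rewrite (negPf sat1N) !addr0 add0r.
Qed.

(** * The deterministic bound *)

Lemma det_competitive_le (R : realType) (acc : access) (alg : det_alg R acc)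
    (a : R) : det_competitive alg a -> a <= (5 - Num.sqrt 17) / 2.
Proof.
move=> alg_a; set r := (5 - _) / 2; rewrite leNgt; apply/negP => r_lt_a.
have sqrt17 : Num.sqrt 17 ^+ 2 = 17 :> R by rewrite sqr_sqrtr.
have sqrt17_ge0 : 0 <= Num.sqrt 17 :> R by rewrite sqrtr_ge0.
have r_root : r ^+ 2 = 5 * r - 2 by rewrite /r; field: sqrt17.
have r_gt0 : 0 < r by rewrite /r; nra.
(* This is [sqrt 17 > 4]. By [r_root], [r (1 + 2 x) = 2 - 2 r], so it makes the value 1 insufficient
   in the last scenario. *)
have r_lt : r < 1 / 2 by rewrite /r; nra.
have y_ge0 : 0 <= r / 2 by lra.
have x_ge0 : 0 <= 1 - r / 2 by lra.
have xE : r * (1 + (1 - r / 2)) = 1 - r / 2 by nra.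
set G := gadget R _ _ x_ge0 y_ge0.
(* The strict inequality, inherited from [r < a], matters: the first two scenarios are tight, with
   bad choices reaching exactly [r] times the optimum. *)
have better (s : seq node) (T : {set node}) : uniq s -> T \subset s ->
    0 < dicut G T -> r * dicut G T < dicut G (sol alg G s).
  move=> s_uniq Ts T_gt0; apply: lt_le_trans (alg_a _ G s s_uniq).
  apply: (@lt_le_trans _ _ (a * dicut G T)); first by rewrite ltr_pM2r.
  by rewrite ler_wpM2l ?dicut_le_opt//; lra.
(* Only keeping both hubs has to be refuted: the sequel uses just that one hub is missing, so the
   case of no hub is covered with [b := true]. *)
have [b hubbN] : exists b, hub (~~ b) \notin sol alg G hubs.
  have := better hubs [set hub true].
  rewrite dicut_one_hub dicut_sol_hubs => /(_ isT).
  have -> : [set hub true] \subset hubs.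
    by apply/fintype.subsetP => u; rewrite !inE => ->.
  case h1: (hub true \in _); case h2: (hub false \in _) => //= /(_ isT) lt_r.
  - by exfalso; have := lt_r ltac:(lra); lra.
  - by exists true; rewrite /= h2.
  - by exists false; rewrite /= h1.
  - by exists true; rewrite /= h2.
have hubbN1 : hub (~~ b) \notin sol alg G (rcons hubs (sat1 b)).
  by apply: contraNN hubbN; apply: sol_rcons_old; case: (b).
(* Once [sat1 b] is accepted, the value is [x] whether or not [hub b] is kept. *)
have sat1bN : sat1 b \notin sol alg G (rcons hubs (sat1 b)).
  have := better (rcons hubs (sat1 b)) [set hub (~~ b); sat1 b].
  rewrite dicut_hub_sat1 dicut_sol_hubs_sat1 (negPf hubbN1) => lt_r.
  apply/negP => sat1b.
  have {}lt_r := lt_r ltac:(by case: (b)).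
  have {}lt_r := lt_r ltac:(by apply/fintype.subsetP => u; rewrite !inE;
    move=> /orP[] /eqP ->; case: (b)).
  move: (lt_r ltac:(lra)).
  by rewrite sat1b; case: ifP => /= _; lra.
have hubbN2 : hub (~~ b) \notin
    sol alg G (rcons (rcons hubs (sat1 b)) (sat2 b)).
  by apply: contraNN hubbN1; apply: sol_rcons_old; case: (b).
have sat1bN2 : sat1 b \notin sol alg G (rcons (rcons hubs (sat1 b)) (sat2 b)).
  by apply: contraNN sat1bN; apply: sol_rcons_old; case: (b).
have := better (rcons (rcons hubs (sat1 b)) (sat2 b))
  [set hub (~~ b); sat1 b; sat2 b].
rewrite dicut_hub_sats dicut_sol_hubs_sats// => lt_r.
have {}lt_r := lt_r ltac:(by case: (b)).
have {}lt_r := lt_r ltac:(by apply/fintype.subsetP => u; rewrite !inE;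
    move=> /orP[/orP[]|] /eqP ->; case: (b)).
move: (lt_r ltac:(lra)).
by case: ifP => _; [|case: (sat2 b \in _)]; rewrite ?mulr1n ?mulr0n; nra.
Qed.

(** * The randomized bound *)

Lemma measurable_dicut_sol (R : realType) (acc : access) (alg : rand_alg R acc)
    (V : finType) (G : digraph R V) (s : seq V) :
  measurable_fun [set: rspace alg]%classic
    (fun w => dicut G (sol (rrun alg w) G s)).
Proof.
move=> _ Y _; rewrite setTI.
(* There are finitely many possible solutions, so every preimage is a finite union of events
   [sol = T]. *)
have -> : ((fun w => dicut G (sol (rrun alg w) G s)) @^-1` Y)%classic =
    (\bigcup_(T in [set T | Y (dicut G T)])
      [set w | sol (rrun alg w) G s = T])%classic.
  apply/seteqP; split=> w /=; first by exists (sol (rrun alg w) G s).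
  by case=> T YT solT; rewrite solT.
apply: fin_bigcup_measurable => [|T _]; first exact: finite_finset.
exact: rrun_measurable.
Qed.

Lemma rand_competitive_le (R : realType) (acc : access) (alg : rand_alg R acc)
    (a : R) : rand_competitive alg a -> a <= 4 / 5.
Proof.
move=> alg_a; have [a_lt0|a_ge0] := ltP a 0; first by lra.
pose G := gadget R 1 0 ler01 (lexx 0).
pose f s w := dicut G (sol (rrun alg w) G s).
have value s (T : {set node}) : uniq s -> T \subset s ->
    ((a * dicut G T)%:E <= \int[rprob alg]_w (f s w)%:E)%E.
  move=> s_uniq Ts; have := alg_a _ G s s_uniq; rewrite unlock.
  by apply: le_trans; rewrite lee_fin ler_wpM2l ?dicut_le_opt.
pose s3 b := rcons hubs (sat1 b).
have value_hubs : (a%:E <= \int[rprob alg]_w (f hubs w)%:E)%E.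
  have := value hubs [set hub true] isT.
  rewrite dicut_one_hub addr0 mulr1; apply.
  by apply/fintype.subsetP => u; rewrite !inE => ->.
have value_sat b : ((a * 2)%:E <= \int[rprob alg]_w (f (s3 b) w)%:E)%E.
  have := value (s3 b) [set hub (~~ b); sat1 b].
  rewrite dicut_hub_sat1 addr0; apply; first by case: b.
  by apply/fintype.subsetP => u; rewrite !inE => /orP[] /eqP ->; case: b.
have f_ge0 s w : (0 <= (f s w)%:E)%E by rewrite lee_fin dicut_ge0.
have f_meas s : measurable_fun [set: rspace alg]%classic (fun w => (f s w)%:E).
  by apply/measurable_EFinP; exact: measurable_dicut_sol.
(* For a fixed outcome [w] the scenarios share the run on [hubs], so a hub dropped there stays
   dropped. *)
have sat_le b w : f (s3 b) w <= 1 + (hub (~~ b) \in sol (rrun alg w) G hubs)%:R.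
  have old c : hub c \in sol (rrun alg w) G (s3 b) ->
      hub c \in sol (rrun alg w) G hubs.
    by apply: sol_rcons_old; case: b c => [] [].
  rewrite /f dicut_sol_hubs_sat1 mul0rn.
  case: (boolP (hub (~~ b) \in sol _ _ (s3 b))) => [/old -> | _].
    by case: (hub b \in _); last case: (sat1 b \in _); rewrite /=; lra.
  have := ler0n R (hub (~~ b) \in sol (rrun alg w) G hubs).
  by case: (hub b \in _); last case: (sat1 b \in _); rewrite /=; lra.
(* Keeping both hubs gives at most 0 + 2 + 2, one hub 1 + 2 + 1, no hub 0 + 1 + 1. *)
have sum_le w : f hubs w + (f (s3 true) w + f (s3 false) w) <= 4.
  have := sat_le true w; have := sat_le false w.
  rewrite [f hubs w]dicut_sol_hubs /=.
  by case: (hub true \in _); case: (hub false \in _) => /=; lra.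
have : ((a + (a * 2 + a * 2))%:E <= 4%:E)%E.
  apply: (@le_trans _ _ (\int[rprob alg]_w
      (f hubs w + (f (s3 true) w + f (s3 false) w))%:E)%E).
    under eq_integral do rewrite !EFinD.
    rewrite !ge0_integralD//; last 2 first.
    - by move=> w _; rewrite adde_ge0.
    - exact: emeasurable_funD.
    by rewrite !EFinD !leeD.
  apply: (@le_trans _ _ (\int[rprob alg]_w (cst 4%:E w))%E).
    apply: ge0_le_integral => //.
    - by move=> w _; rewrite !EFinD !adde_ge0.
    - under eq_fun do rewrite !EFinD.
      by do 2 apply: emeasurable_funD => //.
    - by move=> w _; rewrite lee_fin.
  by rewrite integral_cst// [X in (_ * X)%E]probability_setT mule1.
by rewrite lee_fin; lra.
Qed.

Theorem theorem1p4 (R : realType) (acc : access) :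
  (forall (alg : rand_alg R acc) (a : R),
      rand_competitive alg a -> a <= 4 / 5) /\
  (forall (alg : det_alg R acc) (a : R),
      det_competitive alg a -> a <= (5 - Num.sqrt 17) / 2).
Proof.
split=> alg a; [exact: rand_competitive_le|exact: det_competitive_le].
Qed.
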